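(* Let $(A,\{,\},d)$ be a differential graded Poisson algebra over a field $\Bbbk$ and let $(A^{ue},\partial)$ be a universal enveloping algebra of $A$. Then $(A^{ue},\partial)$ is unique up to isomorphism of differential graded algebras.
   Context: Everything is over a field $\Bbbk$; all algebras have an identity and maps of algebras preserve it; gradings are by $\mathbb{Z}$ and $|x|$ is the degree of a homogeneous element $x$. A differential graded (DG) algebra is a graded algebra with a linear map $d$ of degree $1$ with $d^2=0$ and $d(ab)=d(a)b+(-1)^{|a|}a\,d(b)$ for homogeneous $a,b$. DG algebra maps are graded algebra maps of degree $0$ commuting with differentials. A DG Lie algebra $(L,\{,\},d)$ is a graded vector space with a degree $0$ bracket satisfying $\{a,b\}=-(-1)^{|a||b|}\{b,a\}$ and $\{a,\{b,c\}\}=\{\{a,b\},c\}+(-1)^{|a||b|}\{b,\{a,c\}\}$, and a degree $1$ linear map $d$ with $d^2=0$, $d(\{a,b\})=\{d(a),b\}+(-1)^{|a|}\{a,d(b)\}$. DG Lie algebra maps are degree $0$ linear maps commuting with brackets and differentials. A DG algebra $D$ is regarded as a DG Lie algebra via $[x,y]=xy-(-1)^{|x||y|}yx$. A DG Poisson algebra $(A,\cdot,\{,\},d)$ is a DG algebra $(A,\cdot,d)$ that is graded commutative, $ab=(-1)^{|a||b|}ba$, such that $(A,\{,\},d)$ is a DG Lie algebra and $\{a,bc\}=\{a,b\}c+(-1)^{|a||b|}b\{a,c\}$ for homogeneous $a,b,c$. A DG algebra $(A^{ue},\partial)$ is a universal enveloping algebra of a DG Poisson algebra $(A,\{,\},d)$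 if there exist a DG algebra map $\alpha:(A,d)\to(A^{ue},\partial)$ and a DG Lie algebra map $\beta:(A,\{,\},d)\to(A^{ue},[,],\partial)$ satisfying $\alpha(\{a,b\})=\beta(a)\alpha(b)-(-1)^{|a||b|}\alpha(b)\beta(a)$ and $\beta(ab)=\alpha(a)\beta(b)+(-1)^{|a||b|}\alpha(b)\beta(a)$ for homogeneous $a,b\in A$, such that for any DG algebra $(D,\delta)$ with a DG algebra map $f:(A,d)\to(D,\delta)$ and a DG Lie algebra map $g:(A,\{,\},d)\to(D,[,],\delta)$ satisfying $f(\{a,b\})=g(a)f(b)-(-1)^{|a||b|}f(b)g(a)$ and $g(ab)=f(a)g(b)+(-1)^{|a||b|}f(b)g(a)$ for homogeneous $a,b\in A$, there exists a unique DG algebra map $\phi:(A^{ue},\partial)\to(D,\delta)$ with $\phi\alpha=f$ and $\phi\beta=g$. *)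

(* Defs.v *)
From HB Require Import structures.
From mathcomp Require Import all_boot all_order all_algebra finmap.
From mathcomp Require Import boolp.
Set Implicit Arguments. Unset Strict Implicit. Unset Printing Implicit Defensive.
Import GRing.Theory.
Local Open Scope ring_scope.

Reserved Notation "x ** y" (at level 40, left associativity).

(* [homog n] is the subspace of homogeneous elements of degree n.  It contains
   0 for every n, so the degree |x| of a homogeneous element is always
   introduced together with a hypothesis [homog n x]. *)
HB.mixin Record isGraded (k : fieldType) V of GRing.Lmodule k V := {
  homog : int -> V -> Prop;
  homog0 : forall n, homog n 0;
  homogP : forall n (c : k) (x y : V),
    homog n x -> homog n y -> homog n (c *: x + y);
  homog_direct : forall x : V, exists! c : {fsfun int -> V with 0},
    (forall n, homog n (c n)) /\ x = \sum_(n <- finsupp c) c n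
}.
#[short(type="gradedModType")]
HB.structure Definition GradedModule (k : fieldType) :=
  {V of GRing.Lmodule k V & isGraded k V}.

HB.mixin Record isDGModule (k : fieldType) V of GradedModule k V := {
  diff : V -> V;
  diff_linear : linear diff;
  diff_homog : forall n (x : V), homog n x -> homog (n + 1) (diff x);
  diff_diff : forall x, diff (diff x) = 0
}.
#[short(type="dgModType")]
HB.structure Definition DGModule (k : fieldType) :=
  {V of GradedModule k V & isDGModule k V}.

(* The product is not taken from algType because algType requires 1 != 0,
   whereas the zero algebra is allowed here. *)
HB.mixin Record isDGAlgebra (k : fieldType) A of DGModule k A := {
  aone : A;
  amul : A -> A -> A;
  amulA : associative amul;
  amul1l : left_id aone amul;
  amul1r : right_id aone amul;
  amul_linearl : forall b, linear (fun a => amul a b);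
  amul_linearr : forall a, linear (amul a);
  homog_aone : homog 0 aone;
  homog_amul : forall i j (a b : A),
    homog i a -> homog j b -> homog (i + j) (amul a b);
  diff_amul : forall i j (a b : A), homog i a -> homog j b ->
    diff (amul a b) = amul (diff a) b + ((-1) ^ i : k) *: amul a (diff b)
}.
#[short(type="dgAlgType")]
HB.structure Definition DGAlgebra (k : fieldType) :=
  {A of DGModule k A & isDGAlgebra k A}.

Notation "x ** y" := (amul x y) : ring_scope.

HB.mixin Record isDGLie (k : fieldType) L of DGModule k L := {
  bracket : L -> L -> L;
  bracket_linearl : forall b, linear (fun a => bracket a b);
  bracket_linearr : forall a, linear (bracket a);
  homog_bracket : forall i j (a b : L),
    homog i a -> homog j b -> homog (i + j) (bracket a b);
  bracket_antisym : forall i j (a b : L), homog i a -> homog j b ->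
    bracket a b = - (((-1) ^ (i * j) : k) *: bracket b a);
  bracket_jacobi : forall i j l (a b c : L),
    homog i a -> homog j b -> homog l c ->
    bracket a (bracket b c) =
    bracket (bracket a b) c + ((-1) ^ (i * j) : k) *: bracket b (bracket a c);
  diff_bracket : forall i j (a b : L), homog i a -> homog j b ->
    diff (bracket a b) =
    bracket (diff a) b + ((-1) ^ i : k) *: bracket a (diff b)
}.
#[short(type="dgLieType")]
HB.structure Definition DGLie (k : fieldType) :=
  {L of DGModule k L & isDGLie k L}.

HB.mixin Record isDGPoisson (k : fieldType) A
    of DGAlgebra k A & DGLie k A := {
  amulC : forall i j (a b : A), homog i a -> homog j b ->
    a ** b = ((-1) ^ (i * j) : k) *: (b ** a);
  bracket_amul : forall i j l (a b c : A),
    homog i a -> homog j b -> homog l c ->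
    bracket a (b ** c) =
    bracket a b ** c + ((-1) ^ (i * j) : k) *: (b ** bracket a c)
}.
#[short(type="dgPoissonType")]
HB.structure Definition DGPoisson (k : fieldType) :=
  {A of DGAlgebra k A & DGLie k A & isDGPoisson k A}.

Section Components.
Variables (k : fieldType) (V : gradedModType k).
Implicit Types (x y : V).

Definition homog_parts x : {fsfun int -> V with 0} :=
  sval (cid (homog_direct x)).

Lemma homog_partsP x n : homog n (homog_parts x n).
Proof. by rewrite /homog_parts; case: cid => c /= [[h _] _]. Qed.

Lemma homog_parts_sum x :
  x = \sum_(n <- finsupp (homog_parts x)) homog_parts x n.
Proof. by rewrite /homog_parts; case: cid => c /= [[_ h] _]. Qed.

Lemma homog_parts_unique x (c : {fsfun int -> V with 0}) :
  (forall n, homog n (c n)) -> x = \sum_(n <- finsupp c) c n ->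
  homog_parts x = c.
Proof.
by move=> h e; rewrite /homog_parts; case: cid => c' /= [_]; apply; split.
Qed.

Lemma sum_finsupp (W : zmodType) (G : int -> V -> W)
    (c : {fsfun int -> V with 0}) (S : {fset int}) :
  (forall n, G n 0 = 0) -> (finsupp c `<=` S)%fset ->
  \sum_(n <- finsupp c) G n (c n) = \sum_(n <- S) G n (c n).
Proof.
move=> G0 sub; apply: big_fset_incl => // n _ nc.
by rewrite fsfun_dflt // G0.
Qed.

Lemma homogZ n (c : k) x : homog n x -> homog n (c *: x).
Proof. by move=> h; rewrite -[_ *: _]addr0; apply: homogP => //; apply: homog0. Qed.

Lemma homogB n x y : homog n x -> homog n y -> homog n (x - y).
Proof. by move=> h h'; rewrite addrC -scaleN1r; apply: homogP. Qed.

Lemma homog_parts_linear (c : k) x y n :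
  homog_parts (c *: x + y) n = c *: homog_parts x n + homog_parts y n.
Proof.
pose S := (finsupp (homog_parts x) `|` finsupp (homog_parts y))%fset.
pose F := [fsfun n in S => c *: homog_parts x n + homog_parts y n | 0]
  : {fsfun int -> V with 0}.
have FE m : F m = c *: homog_parts x m + homog_parts y m.
  rewrite fsfunE; case: ifPn => //.
  rewrite inE negb_or => /andP[hx hy].
  by rewrite !fsfun_dflt // scaler0 addr0.
have -> : homog_parts (c *: x + y) = F; last exact: FE.
apply: homog_parts_unique => [m|].
  by rewrite FE; apply: homogP; apply: homog_partsP.
rewrite (@sum_finsupp _ (fun=> id) F S) //; last first.
  by apply/fsubsetP => m; rewrite mem_finsupp fsfunE; case: ifP => //; rewrite eqxx.
under eq_bigr do rewrite FE.
rewrite big_split -scaler_sumr.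
rewrite -(@sum_finsupp _ (fun=> id) (homog_parts x)) ?fsubsetUl //.
rewrite -(@sum_finsupp _ (fun=> id) (homog_parts y)) ?fsubsetUr //.
by rewrite -!homog_parts_sum.
Qed.

Lemma homog_parts_homog i x n :
  homog i x -> homog_parts x n = if n == i then x else 0.
Proof.
move=> hx.
pose F := [fsfun n in [fset i]%fset => x | 0] : {fsfun int -> V with 0}.
have FE m : F m = if m == i then x else 0 by rewrite fsfunE inE.
rewrite -FE; congr (fun_of_fsfun _ n); apply: homog_parts_unique => [m|].
  by rewrite FE; case: eqP => [->|_] //; apply: homog0.
rewrite (@sum_finsupp _ (fun=> id) F [fset i]%fset) //.
  by rewrite big_seq_fset1 FE eqxx.
apply/fsubsetP => m; rewrite mem_finsupp fsfunE.
by case: ifP => //; rewrite eqxx.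
Qed.

End Components.

Section Commutator.
Variables (k : fieldType) (D : dgAlgType k).
Implicit Types (a b c x y : D).

(* The bilinear extension of [x,y] = xy - (-1)^(|x||y|) yx. *)
Definition commutator x y : D :=
  \sum_(i <- finsupp (homog_parts x)) \sum_(j <- finsupp (homog_parts y))
    (homog_parts x i ** homog_parts y j
     - ((-1) ^ (i * j) : k) *: (homog_parts y j ** homog_parts x i)).

Lemma amulDl a b c : (a + b) ** c = a ** c + b ** c.
Proof. by have := amul_linearl c 1 a b; rewrite !scale1r. Qed.
Lemma amulDr a b c : a ** (b + c) = a ** b + a ** c.
Proof. by have := amul_linearr a 1 b c; rewrite !scale1r. Qed.
Lemma amul0l a : 0 ** a = 0.
Proof. by have := amulDl 0 0 a; rewrite addr0 => /eqP; rewrite addrC -subr_eq subrr => /eqP. Qed.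
Lemma amul0r a : a ** 0 = 0.
Proof. by have := amulDr a 0 0; rewrite addr0 => /eqP; rewrite addrC -subr_eq subrr => /eqP. Qed.
Lemma amulZl (z : k) a b : (z *: a) ** b = z *: (a ** b).
Proof. by have := amul_linearl b z a 0; rewrite !addr0 amul0l addr0. Qed.
Lemma amulZr (z : k) a b : a ** (z *: b) = z *: (a ** b).
Proof. by have := amul_linearr a z b 0; rewrite !addr0 amul0r addr0. Qed.
Lemma amulBl a b c : (a - b) ** c = a ** c - b ** c.
Proof. by rewrite amulDl -scaleN1r amulZl scaleN1r. Qed.
Lemma amulBr a b c : a ** (b - c) = a ** b - a ** c.
Proof. by rewrite amulDr -scaleN1r amulZr scaleN1r. Qed.

Let K (i j : int) a b := a ** b - ((-1) ^ (i * j) : k) *: (b ** a).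

Let Kl i j b : linear (fun a => K i j a b).
Proof.
move=> z x y; rewrite /K amulDl amulDr amulZl amulZr scalerDr scalerBr.
by rewrite opprD addrACA !scalerA [z * _]mulrC.
Qed.
Let Kr i j a : linear (K i j a).
Proof.
move=> z x y; rewrite /K amulDl amulDr amulZl amulZr scalerDr scalerBr.
by rewrite opprD addrACA !scalerA [z * _]mulrC.
Qed.
Let K0l i j b : K i j 0 b = 0.
Proof. by rewrite /K amul0l amul0r scaler0 subr0. Qed.
Let K0r i j a : K i j a 0 = 0.
Proof. by rewrite /K amul0l amul0r scaler0 subr0. Qed.

Let commutator_on (S T : {fset int}) x y :
  (finsupp (homog_parts x) `<=` S)%fset ->
  (finsupp (homog_parts y) `<=` T)%fset ->
  commutator x y = \sum_(i <- S) \sum_(j <- T)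
                     K i j (homog_parts x i) (homog_parts y j).
Proof.
move=> sS sT; rewrite /commutator.
rewrite (@sum_finsupp _ _ _ (fun i a => \sum_(j <- finsupp (homog_parts y))
  K i j a (homog_parts y j)) _ S) //; last by move=> n; apply: big1.
by apply: eq_bigr => i _; apply: (@sum_finsupp _ _ _ (fun j b => K i j _ b)).
Qed.

Lemma commutator_linearl b : linear (fun a => commutator a b).
Proof.
move=> z x y; pose T := finsupp (homog_parts b).
pose S := (finsupp (homog_parts x) `|` (finsupp (homog_parts y)
            `|` finsupp (homog_parts (z *: x + y)%R)))%fset.
have sx : (finsupp (homog_parts x) `<=` S)%fset by apply: fsubsetUl.
have sy : (finsupp (homog_parts y) `<=` S)%fset.
  by apply: fsubsetU; rewrite fsubsetUl orbT.
have sz : (finsupp (homog_parts (z *: x + y)%R) `<=` S)%fset.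
  by apply: fsubsetU; rewrite fsubsetUr orbT.
rewrite (commutator_on sx (fsubset_refl T)) (commutator_on sy (fsubset_refl T)).
rewrite (commutator_on sz (fsubset_refl T)) scaler_sumr -big_split /=.
apply: eq_bigr => i _; rewrite scaler_sumr -big_split /=.
by apply: eq_bigr => j _; rewrite homog_parts_linear Kl.
Qed.

Lemma commutator_linearr a : linear (commutator a).
Proof.
move=> z x y; pose T := finsupp (homog_parts a).
pose S := (finsupp (homog_parts x) `|` (finsupp (homog_parts y)
            `|` finsupp (homog_parts (z *: x + y)%R)))%fset.
have sx : (finsupp (homog_parts x) `<=` S)%fset by apply: fsubsetUl.
have sy : (finsupp (homog_parts y) `<=` S)%fset.
  by apply: fsubsetU; rewrite fsubsetUl orbT.
have sz : (finsupp (homog_parts (z *: x + y)%R) `<=` S)%fset.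
  by apply: fsubsetU; rewrite fsubsetUr orbT.
rewrite (commutator_on (fsubset_refl T) sx) (commutator_on (fsubset_refl T) sy).
rewrite (commutator_on (fsubset_refl T) sz) scaler_sumr -big_split /=.
apply: eq_bigr => i _; rewrite scaler_sumr -big_split /=.
by apply: eq_bigr => j _; rewrite homog_parts_linear Kr.
Qed.

Lemma commutatorE i j a b : homog i a -> homog j b ->
  commutator a b = a ** b - ((-1) ^ (i * j) : k) *: (b ** a).
Proof.
move=> ha hb.
have sub n x : homog n x -> (finsupp (homog_parts x) `<=` [fset n])%fset.
  move=> hx; apply/fsubsetP => m.
  rewrite mem_finsupp (homog_parts_homog _ hx) inE.
  by case: (m == n) => //; rewrite eqxx.
rewrite (commutator_on (sub _ _ ha) (sub _ _ hb)) !big_seq_fset1.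
by rewrite (homog_parts_homog _ ha) (homog_parts_homog _ hb) !eqxx.
Qed.

Lemma homog_commutator i j a b :
  homog i a -> homog j b -> homog (i + j) (commutator a b).
Proof.
move=> ha hb; rewrite (commutatorE ha hb).
apply: homogB; first exact: homog_amul.
by apply: homogZ; rewrite addrC; apply: homog_amul.
Qed.

Let signD (m n : int) : (-1 : k) ^ (m + n) = (-1) ^ m * (-1) ^ n.
Proof. by apply: expfzDr; rewrite oppr_eq0 oner_eq0. Qed.
Let sign2 (m : int) : (-1 : k) ^ m * (-1) ^ m = 1.
Proof. by rewrite -expfzMl mulrNN mulr1 exp1rz. Qed.

Lemma commutator_antisym i j a b : homog i a -> homog j b ->
  commutator a b = - (((-1) ^ (i * j) : k) *: commutator b a).
Proof.
move=> ha hb; rewrite (commutatorE ha hb) (commutatorE hb ha).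
by rewrite (mulrC j) scalerBr scalerA sign2 scale1r opprB.
Qed.

Lemma commutator_jacobi i j l a b c :
  homog i a -> homog j b -> homog l c ->
  commutator a (commutator b c) =
  commutator (commutator a b) c
  + ((-1) ^ (i * j) : k) *: commutator b (commutator a c).
Proof.
move=> ha hb hc.
rewrite (commutatorE ha (homog_commutator hb hc)).
rewrite (commutatorE (homog_commutator ha hb) hc).
rewrite (commutatorE hb (homog_commutator ha hc)).
rewrite (commutatorE ha hb) (commutatorE hb hc) (commutatorE ha hc).
rewrite mulrDl !mulrDr !signD (mulrC j i).
set s := _ ^ (i * j); set t := _ ^ (i * l); set u := _ ^ (j * l).
have ss : s * s = 1 := sign2 _.
rewrite !(amulBl, amulBr, amulZl, amulZr) !amulA.
rewrite !scalerBr !scalerA.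
rewrite !mulrA ss !mul1r.
move: (a ** b ** c) (a ** c ** b) (b ** c ** a) (c ** b ** a) (b ** a ** c)
  (c ** a ** b) => e1 e2 e3 e4 e5 e6.
rewrite (mulrC u t) (mulrC (t * u) s) mulrA.
rewrite !opprB [RHS]addrACA !subrKA addrACA [RHS]addrACA.
by congr (_ + _); rewrite addrC.
Qed.

Lemma diff_commutator i j a b : homog i a -> homog j b ->
  diff (commutator a b) =
  commutator (diff a) b + ((-1) ^ i : k) *: commutator a (diff b).
Proof.
move=> ha hb; have lin z x y := diff_linear z (x : D) y.
have dN x y : diff (x - y) = diff x - diff y :> D.
  by rewrite addrC -scaleN1r lin scaleN1r addrC.
have d0 : diff 0 = 0 :> D by have := dN 0 0; rewrite !subrr.
have dZ z x : diff (z *: x) = z *: diff x :> D.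
  by have := lin z x 0; rewrite !addr0 d0 addr0.
rewrite (commutatorE ha hb) (commutatorE (diff_homog _ _ ha) hb).
rewrite (commutatorE ha (diff_homog _ _ hb)) dN dZ.
rewrite (diff_amul _ _ _ _ ha hb) (diff_amul _ _ _ _ hb ha).
rewrite mulrDl mulrDr mul1r mulr1 !signD.
rewrite scalerDr scalerBr !scalerA.
rewrite (mulrC ((-1) ^ (i * j)) ((-1) ^ i)) mulrA sign2 mul1r.
by rewrite opprD [X in _ + X = _]addrC addrACA.
Qed.

End Commutator.

(* An alias, so that a DG algebra (in particular a Poisson one) is not itself
   given the commutator as its canonical bracket. *)
Definition lie_of (k : fieldType) (D : dgAlgType k) : Type := D.

HB.instance Definition _ (k : fieldType) (D : dgAlgType k) :=
  DGModule.copy (lie_of D) D.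
HB.instance Definition _ (k : fieldType) (D : dgAlgType k) :=
  isDGLie.Build k (lie_of D) (@commutator_linearl k D) (@commutator_linearr k D)
    (@homog_commutator k D) (@commutator_antisym k D) (@commutator_jacobi k D)
    (@diff_commutator k D).

Record is_dg_algebra_map (k : fieldType) (A B : dgAlgType k) (f : A -> B) :
    Prop := {
  dg_algebra_map_linear : linear f;
  dg_algebra_map_homog : forall n a, homog n a -> homog n (f a);
  dg_algebra_map_diff : forall a, f (diff a) = diff (f a);
  dg_algebra_map_one : f aone = aone;
  dg_algebra_map_mul : forall a b, f (a ** b) = f a ** f b
}.

Record is_dg_lie_map (k : fieldType) (L M : dgLieType k) (g : L -> M) :
    Prop := {
  dg_lie_map_linear : linear g;
  dg_lie_map_homog : forall n a, homog n a -> homog n (g a);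
  dg_lie_map_diff : forall a, g (diff a) = diff (g a);
  dg_lie_map_bracket : forall a b, g (bracket a b) = bracket (g a) (g b)
}.

Record is_enveloping_pair (k : fieldType) (A : dgPoissonType k)
    (D : dgAlgType k) (f : A -> D) (g : A -> lie_of D) : Prop := {
  enveloping_algebra_map : is_dg_algebra_map f;
  enveloping_lie_map : is_dg_lie_map g;
  enveloping_bracket : forall i j (a b : A), homog i a -> homog j b ->
    f (bracket a b) = (g a : D) ** f b - ((-1) ^ (i * j) : k) *: (f b ** g a);
  enveloping_mul : forall i j (a b : A), homog i a -> homog j b ->
    (g (a ** b) : D) = f a ** g b + ((-1) ^ (i * j) : k) *: (f b ** g a)
}.

Definition is_universal_enveloping (k : fieldType) (A : dgPoissonType k)
    (U : dgAlgType k) : Prop :=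
  exists (alpha : A -> U) (beta : A -> lie_of U),
    is_enveloping_pair alpha beta /\
    forall (D : dgAlgType k) (f : A -> D) (g : A -> lie_of D),
      is_enveloping_pair f g ->
      exists! phi : U -> D,
        [/\ is_dg_algebra_map phi, phi \o alpha = f & phi \o beta = g].

Definition dg_algebra_isomorphic (k : fieldType) (U V : dgAlgType k) : Prop :=
  exists (phi : U -> V) (psi : V -> U),
    [/\ is_dg_algebra_map phi, is_dg_algebra_map psi,
        cancel phi psi & cancel psi phi].

(* Main.v *)
Require Import Defs.
From mathcomp Require Import all_boot all_order all_algebra.

(** An enveloping algebra with its pair is an initial object among DG algebras carrying an
    enveloping pair from [A], and initial objects are isomorphic. Existence gives maps [phi] and
    [psi] in both directions; uniqueness, in the form of [universal_endomorphism_eq_id], forces both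
    composites to be identities. *)

Lemma is_dg_algebra_map_id (k : fieldType) (U : dgAlgType k) :
  is_dg_algebra_map (@id U).
Proof. by split. Qed.

Lemma is_dg_algebra_map_comp (k : fieldType) (U V W : dgAlgType k)
    (psi : V -> W) (phi : U -> V) :
  is_dg_algebra_map psi -> is_dg_algebra_map phi ->
  is_dg_algebra_map (psi \o phi).
Proof.
case=> psiL psiH psiD psi1 psiM [phiL phiH phiD phi1 phiM]; split=> /=.
- by move=> c x y; rewrite /= phiL psiL.
- by move=> n a /phiH/psiH.
- by move=> a; rewrite phiD psiD.
- by rewrite phi1 psi1.
- by move=> a b; rewrite phiM psiM.
Qed.

(** Both [chi] and the identity solve the universal problem that [U] poses to itself, so uniqueness
    identifies them. *)
Lemma universal_endomorphism_eq_id (k : fieldType) (A : dgPoissonType k)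
    (U : dgAlgType k) (alpha : A -> U) (beta : A -> lie_of U) (chi : U -> U) :
  (exists! phi : U -> U,
     [/\ is_dg_algebra_map phi, phi \o alpha = alpha & phi \o beta = beta]) ->
  is_dg_algebra_map chi -> chi \o alpha = alpha -> chi \o beta = beta ->
  chi =1 id.
Proof.
case=> u [_ uniq_u] chiM chia chib x.
have <- : u = chi by apply: uniq_u; split.
have -> // : u = id.
by apply: uniq_u; split=> //; apply: is_dg_algebra_map_id.
Qed.

Theorem proposition3p15 (k : fieldType) (A : dgPoissonType k)
    (U V : dgAlgType k)
    (hU : is_universal_enveloping A U) (hV : is_universal_enveloping A V) :
  dg_algebra_isomorphic U V.
Proof.
case: hU => alpha [beta [pU univU]]; case: hV => alpha' [beta' [pV univV]].
have [phi [[phiM phia phib] _]] := univU V alpha' beta' pV.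
have [psi [[psiM psia psib] _]] := univV U alpha beta pU.
exists phi, psi; split=> //.
(* The universal property of [U] is tested on [U] with its own pair; [psi \o phi] carries [alpha] to
   [alpha'] and back, and likewise for [beta]. *)
- apply: (universal_endomorphism_eq_id _ _ _ _ _ (psi \o phi) (univU U _ _ pU)).
  + exact: is_dg_algebra_map_comp.
  + by rewrite -compA phia.
  + by rewrite -compA phib.
- apply: (universal_endomorphism_eq_id _ _ _ _ _ (phi \o psi) (univV V _ _ pV)).
  + exact: is_dg_algebra_map_comp.
  + by rewrite -compA psia.
  + by rewrite -compA psib.
Qed.
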